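(* Let $M\subset\mathbb C$ be a nonempty compact set. The space $C(M)^d$ of continuous functions $M\to\mathbb C^d$, equipped with the polyproduct $\circledcirc$ and the norm $\|\cdot\|$, and denoted by $C_\Lambda(M)$, is a commutative unital Banach algebra. The algebra norm $\|\cdot\|$ is equivalent to $|\cdot|_M$, and the functions whose components are given by polynomials in $w$ and $\overline w$ are dense in $C_\Lambda(M)$.
   Context: Let $\Lambda=\{\lambda_1,\dots,\lambda_d\}\subset\mathbb C$ consist of $d$ distinct points and let $p(z)=(z-\lambda_1)\cdots(z-\lambda_d)$. For $f\in C(M)^d$ put $|f|_M=\max_{w\in M}\max_{1\le j\le d}|f_j(w)|$. For $a\in\mathbb C^d$ let $\Box a$ be the $d\times d$ matrix with entries $(\Box a)_{ij}=a_i-a_j$. Let $L$ be the $d\times d$ matrix with zero diagonal and $L_{ij}=1/(\lambda_i-\lambda_j)$ for $i\neq j$, and let $\ell\in\mathbb C^d$ have components $\ell_j=1/p'(\lambda_j)$. With $\circ$ the elementwise (Hadamard) product, the polyproduct is $$(f\circledcirc g)(w)=(f\circ g)(w)-w\,\bigl(L\circ\Box f(w)\circ\Box g(w)\bigr)\ell .$$ The norm is $\|f\|=\sup_{|g|_M\le1}|f\circledcirc g|_M$, the supremum being over $g\in C(M)^d$. The unit is the constant function $\mathbf 1=(1,\dots,1)^t$. *)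

(* Defs.v *)
From HB Require Import structures.
From mathcomp Require Import all_boot all_order all_algebra.
From mathcomp Require Import all_classical all_reals all_analysis.
From mathcomp Require Export complex polyXY.

Set Implicit Arguments.
Unset Strict Implicit.
Unset Printing Implicit Defensive.

Import Order.TTheory GRing.Theory Num.Theory.
Import numFieldNormedType.Exports.

Local Open Scope classical_set_scope.
Local Open Scope ring_scope.
Local Open Scope complex_scope.

(* R[i] with the topology given by its modulus; R^o carries it for every
   numFieldType, but the concrete type R[i] has no instance in the library. *)
HB.instance Definition _ (R : realType) := PseudoPointedMetric.copy R[i] R[i]^o.

Section continuous_lmod.
Context {K : numFieldType} {X : topologicalType} {V : normedModType K}.
Implicit Types f g : continuousType X V.

Let zero_continuous : continuous (fun _ : X => 0 : V).
Proof. by move=> x; exact: cvg_cst. Qed.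

Let opp_continuous f : continuous (fun x => - f x).
Proof. by move=> x; apply: cvgN; exact: cts_fun. Qed.

Let add_continuous f g : continuous (fun x => f x + g x).
Proof. by move=> x; apply: cvgD; exact: cts_fun. Qed.

Let scale_continuous (a : K) f : continuous (fun x => a *: f x).
Proof. by move=> x; apply: cvgZl_tmp; exact: cts_fun. Qed.

Let zero : continuousType X V := mkcts zero_continuous.
Let opp f : continuousType X V := mkcts (@opp_continuous f).
Let add f g : continuousType X V := mkcts (@add_continuous f g).
Let scale (a : K) f : continuousType X V := mkcts (@scale_continuous a f).

Let addA : associative add.
Proof. by move=> f g h; apply/continuousEP => x; exact: addrA. Qed.
Let addC : commutative add.
Proof. by move=> f g; apply/continuousEP => x; exact: addrC. Qed.
Let add0 : left_id zero add.
Proof. by move=> f; apply/continuousEP => x; exact: add0r. Qed.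
Let addN : left_inverse zero opp add.
Proof. by move=> f; apply/continuousEP => x; exact: addNr. Qed.

HB.instance Definition _ :=
  GRing.isZmodule.Build (continuousType X V) addA addC add0 addN.

Let scaleA a b f : scale a (scale b f) = scale (a * b) f.
Proof. by apply/continuousEP => x; exact: scalerA. Qed.
Let scale1 : left_id 1 scale.
Proof. by move=> f; apply/continuousEP => x; exact: scale1r. Qed.
Let scaleDr : right_distributive scale +%R.
Proof. by move=> a f g; apply/continuousEP => x; exact: scalerDr. Qed.
Let scaleDl f : {morph scale^~ f : a b / a + b}.
Proof. by move=> a b; apply/continuousEP => x; exact: scalerDl. Qed.

HB.instance Definition _ :=
  GRing.Zmodule_isLmodule.Build K (continuousType X V)
    scaleA scale1 scaleDr scaleDl.

End continuous_lmod.

(* `|a| is an element of R[i] with zero imaginary part; its Re is the modulus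
   as a real number. *)
Record commutative_unital_banach_algebra (R : realType) (A : lmodType R[i])
    (mul : A -> A -> A) (one : A) (nrm : A -> R) : Prop := {
  banach_mulA : associative mul;
  banach_mulC : commutative mul;
  banach_mul1 : left_id one mul;
  banach_mulDl : left_distributive mul +%R;
  banach_mulZl : forall (a : R[i]) (x y : A), mul (a *: x) y = a *: mul x y;
  banach_norm_eq0 : forall x, nrm x = 0 -> x = 0;
  banach_normD : forall x y, nrm (x + y) <= nrm x + nrm y;
  banach_normZ : forall (a : R[i]) x, nrm (a *: x) = complex.Re `|a| * nrm x;
  banach_normM : forall x y, nrm (mul x y) <= nrm x * nrm y;
  banach_norm1 : nrm one = 1;
  banach_complete : forall u : nat -> A,
    (forall e : R, 0 < e -> exists N, forall m n, (N <= m)%N -> (N <= n)%N ->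
       nrm (u m - u n) < e) ->
    exists l : A, forall e : R, 0 < e -> exists N, forall n, (N <= n)%N ->
       nrm (u n - l) < e }.

Definition equivalent_norms (R : realType) (A : Type) (nrm1 nrm2 : A -> R) :
    Prop :=
  exists c1 c2 : R, [/\ 0 < c1, 0 < c2 &
    forall x, c1 * nrm2 x <= nrm1 x /\ nrm1 x <= c2 * nrm2 x].

Definition dense_for (R : realType) (A : zmodType) (nrm : A -> R)
    (D : set A) : Prop :=
  forall (x : A) (e : R), 0 < e -> exists2 y, D y & nrm (x - y) < e.

Section polyproduct_algebra.
Context {K : fieldType} {d : nat}.
Variable lam : 'I_d -> K.

Definition nodal_poly : {poly K} := \prod_(j < d) ('X - (lam j)%:P).

Definition ell : 'cV[K]_d := \col_j (nodal_poly^`().[lam j])^-1.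

Definition Lmx : 'M[K]_d :=
  \matrix_(i, j) (if i == j then 0 else (lam i - lam j)^-1).

Definition box (a : 'cV[K]_d) : 'M[K]_d := \matrix_(i, j) (a i 0 - a j 0).

Definition hadamard m n (A B : 'M[K]_(m, n)) : 'M[K]_(m, n) := map2_mx *%R A B.

Definition polyprod_at (w : K) (a b : 'cV[K]_d) : 'cV[K]_d :=
  hadamard a b - w *: (hadamard (hadamard Lmx (box a)) (box b) *m ell).

End polyproduct_algebra.

Section polyproduct_continuity.
Context {K : numFieldType} {X : topologicalType} {d : nat}.

Let cV_continuous (f : X -> 'cV[K]_d) :
  (forall i, continuous (fun w => f w i 0)) -> continuous f.
Proof.
move=> cf w A [B Bw BA].
have : \forall v \near w, forall i, B i 0 (f v i 0).
  pose P (i : 'I_d) (v : X) := B i 0 (f v i 0).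
  apply: (@filter_forall _ _ P (nbhs w)) => i.
  exact: (cf i w _ (Bw i 0)).
by apply: filterS => v Bv; apply: BA => i j; rewrite ord1; exact: Bv.
Qed.

Let coord_cts (f : X -> 'cV[K]_d) i : continuous f ->
  continuous (fun w => f w i 0).
Proof.
move=> cf w; apply: (@continuous_comp _ _ _ f (fun A : 'cV[K]_d => A i 0)).
  exact: cf.
exact: coord_continuous.
Qed.

Fact polyprod_at_continuous (lam : 'I_d -> K) (z : X -> K)
    (f g : X -> 'cV[K]_d) :
  continuous z -> continuous f -> continuous g ->
  continuous (fun w => polyprod_at lam (z w) (f w) (g w)).
Proof.
move=> cz cf cg.
have cB (h : X -> 'cV[K]_d) i j : continuous h ->
    continuous (fun w => box (h w) i j).
  move=> ch; have -> : (fun w => box (h w) i j) = fun w => h w i 0 - h w j 0.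
    by apply/funext => w; rewrite mxE.
  by move=> w; apply: cvgB; exact: coord_cts.
apply: cV_continuous => i.
have -> : (fun v => polyprod_at lam (z v) (f v) (g v) i 0) =
    fun v => f v i 0 * g v i 0 - z v *
      \sum_j (Lmx lam i j * box (f v) i j * box (g v) i j) * ell lam j 0.
  apply/funext => v; rewrite !mxE; congr (_ - _ * _).
  by apply: eq_bigr => j _; rewrite !mxE.
move=> w; apply: cvgB; first by apply: cvgM; exact: coord_cts.
apply: cvgM; first exact: cz.
apply: cvg_big => [|j _]; first exact: add_continuous.
apply: cvgM; last exact: cvg_cst.
apply: cvgM; last exact: cB.
by apply: cvgM; [exact: cvg_cst | exact: cB].
Qed.

End polyproduct_continuity.

(* C(M)^d, where the set M stands for the type set_type M with the topology
   induced from R[i]. *)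
Definition CM (R : realType) (d : nat) (M : set R[i]) :=
  continuousType M 'cV[R[i]]_d.

HB.instance Definition _ (R : realType) (d : nat) (M : set R[i]) :=
  GRing.Lmodule.on (CM d M).

Section CLambda.
Context {R : realType} {d : nat}.
Variables (lam : 'I_d -> R[i]) (M : set R[i]).

Fact polyprod_continuous (f g : CM d M) :
  continuous (fun w : M => polyprod_at lam (set_val w) (f w) (g w)).
Proof.
apply: (@polyprod_at_continuous R[i] M d lam set_val f g).
- exact: initial_continuous.
- exact: cts_fun.
- exact: cts_fun.
Qed.

Definition polyprod (f g : CM d M) : CM d M := mkcts (@polyprod_continuous f g).

Definition CM_one : CM d M := cst (const_mx 1).

(* |f|_M: the inner maximum is over nonnegative reals, so starting it at 0 is
   harmless for d > 0; the outer supremum is attained for M compact. *)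
Definition maxnorm (f : CM d M) : R :=
  sup [set \big[Num.max/0]_(j < d) complex.Re `|f w j 0| | w in [set: M]].

(* sup is 0 on sets that are not bounded above, so definiteness of polynorm
   already entails that the supremum is finite. *)
Definition polynorm (f : CM d M) : R :=
  sup [set maxnorm (polyprod f g) | g in [set g : CM d M | maxnorm g <= 1]].

Definition polynomial_in_conj (f : CM d M) : Prop :=
  exists q : 'I_d -> {poly {poly R[i]}},
    forall (w : M) (j : 'I_d), f w j 0 = (q j).[set_val w, (set_val w)^*].

End CLambda.

(* Main.v *)
Require Import Defs.
From mathcomp Require Import all_boot all_order all_algebra.
From mathcomp Require Import all_classical all_reals all_analysis.
From mathcomp Require Import ring lra.
Import Order.TTheory GRing.Theory Num.Theory.
Import numFieldNormedType.Exports.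
Import ComplexField.Normc.

(** The polyproduct is multiplication of polynomials in disguise.  Let p be the
    nodal polynomial and, for a vector a, let A be the polynomial of degree less
    than d with A(lam j) = a_j (its Lagrange interpolant).  Since the basis
    polynomials delta_i satisfy, for i <> j,
      delta_i delta_j = p L_ij (ell_j delta_i - ell_i delta_j)
    and add up to 1, the product A B differs from the interpolant of the Hadamard
    product of a and b by exactly p C, where C interpolates
    (L o box a o box b) ell.  Modulo p - w one may replace p by w, so the fiber at
    w of the polyproduct is K[z]/(p - w) written in the basis of the delta_i
    (lagrange_interp_polyprod).  Associativity and commutativity follow.

    The norm is the operator norm of the regular representation on the Banach
    space C(M)^d with the uniform norm.  For any bounded unital multiplication on
    a complete normed space whose unit has norm 1 this operator norm is a
    submultiplicative norm, equivalent to the original one: it is at least N x by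
    testing on the unit and at most C * N x by boundedness.  Completeness is
    inherited through the equivalence (regular_norm_banach).  The polyproduct is
    bounded because M is (maxnorm_polyprod), and uniform limits of continuous
    functions are continuous (maxnorm_complete).

    By the equivalence of norms, density is the Stone-Weierstrass theorem for
    polynomials in w and its conjugate.  The squared distance to a point c is such
    a polynomial, so for u a small multiple of it, (1 - u^n)^(k^n) is one as well:
    it takes values in [0, 1], is close to 1 near c and close to 0 away from c
    (polynomial_bump; this is the function of Brosowski and Deutsch).  Cover M by
    finitely many small discs on which f is almost constant, and starting from 0
    move the approximation q to q + (f c - q) h for the bump h of each disc in
    turn.  Each step pulls q towards f near c and changes it little elsewhere
    (polynomial_patching). *)

Set Implicit Arguments.
Unset Strict Implicit.
Unset Printing Implicit Defensive.

Local Open Scope classical_set_scope.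
Local Open Scope ring_scope.

(** * Real-valued modulus on R[i] *)

Section modulus.
Context {R : realType}.
Implicit Types z : R[i].

Definition cmod z : R := complex.Re `|z|.

Lemma cmodE z : `|z| = (cmod z)%:C%C.
Proof. by []. Qed.

Lemma cmod_ge0 z : 0 <= cmod z.
Proof. by case: z => a b; exact: sqrtr_ge0. Qed.

Lemma cmod_real (x : R) : cmod x%:C%C = `|x|.
Proof. by rewrite /cmod /= expr0n addr0 sqrtr_sqr. Qed.

Lemma cmod0 : cmod 0 = 0.
Proof. by have := cmod_real 0; rewrite normr0. Qed.

Lemma cmod1 : cmod 1 = 1.
Proof. by have := cmod_real 1; rewrite normr1. Qed.

Lemma cmod_eq0 z : cmod z = 0 -> z = 0.
Proof. exact: eq0_normc. Qed.

Lemma cmodM z1 z2 : cmod (z1 * z2) = cmod z1 * cmod z2.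
Proof. exact: normcM. Qed.

Lemma cmodV z : cmod z^-1 = (cmod z)^-1.
Proof. exact: normcV. Qed.

Lemma cmodN z : cmod (- z) = cmod z.
Proof. by rewrite /cmod normrN. Qed.

Lemma cmodB z1 z2 : cmod (z1 - z2) = cmod (z2 - z1).
Proof. by rewrite -cmodN opprB. Qed.

Lemma le_cmodD z1 z2 : cmod (z1 + z2) <= cmod z1 + cmod z2.
Proof. by rewrite -lecR rmorphD /= -!cmodE ler_normD. Qed.

Lemma le_cmod_sum (I : Type) (s : seq I) (F : I -> R[i]) :
  cmod (\sum_(i <- s) F i) <= \sum_(i <- s) cmod (F i).
Proof.
elim/big_ind2 : _ => [|x u y v xu yv|//]; first by rewrite cmod0.
exact: le_trans (le_cmodD _ _) (lerD xu yv).
Qed.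

(** The opposite inequality is the given one for the inverse scalar. *)
Lemma homogeneous_of_le (A : lmodType R[i]) (N : A -> R) :
  (forall x, 0 <= N x) -> (forall (a : R[i]) x, N (a *: x) <= cmod a * N x) ->
  forall (a : R[i]) x, N (a *: x) = cmod a * N x.
Proof.
move=> N_ge0 leZ a x; apply/eqP; rewrite eq_le leZ/=.
have [->|a0] := eqVneq a 0; first by rewrite cmod0 mul0r.
have na0 : 0 < cmod a.
  by rewrite lt_neqAle cmod_ge0 andbT eq_sym; apply: contra_neq a0 => /cmod_eq0.
rewrite -ler_pdivlMl// -cmodV; apply: le_trans (leZ _ _).
by rewrite scalerA mulVf// scale1r.
Qed.

End modulus.

(** * Fibers of the polyproduct as quotients of the polynomial ring *)

Section fiber_algebra.
Context {K : fieldType} {d : nat}.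
Variable lam : 'I_d -> K.
Hypothesis lam_inj : injective lam.

Let p := nodal_poly lam.

Let size_p : size p = d.+1.
Proof. by rewrite size_prod_XsubC /index_enum -enumT size_enum_ord. Qed.

Lemma eq_poly_nodes (q r : {poly K}) : (size q <= d)%N -> (size r <= d)%N ->
  (forall i, q.[lam i] = r.[lam i]) -> q = r.
Proof.
move=> sq sr qr; apply/eqP; rewrite -subr_eq0; apply/eqP.
apply: (@roots_geq_poly_eq0 _ _ [seq lam i | i <- enum 'I_d]).
- apply/allP => _ /mapP[i _ ->]; by rewrite rootE !hornerE qr subrr.
- by rewrite map_inj_uniq ?enum_uniq.
- rewrite size_map size_enum_ord (leq_trans (size_polyD _ _))// size_polyN.
  by rewrite geq_max sq.
Qed.

Definition conodal (i : 'I_d) : {poly K} :=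
  \prod_(j < d | j != i) ('X - (lam j)%:P).

Lemma nodalE i : p = ('X - (lam i)%:P) * conodal i.
Proof. by rewrite /p /nodal_poly (bigD1 i). Qed.

Lemma conodal_eq0 i j : i != j -> (conodal i).[lam j] = 0.
Proof.
move=> ij; rewrite /conodal (bigD1 j) 1?eq_sym//= hornerM !hornerE subrr.
by rewrite mul0r.
Qed.

Lemma ellE i : ell lam i 0 = ((conodal i).[lam i])^-1.
Proof.
rewrite mxE -/p (nodalE i) derivM derivXsubC mul1r hornerD hornerM !hornerE.
by rewrite subrr mul0r addr0.
Qed.

Lemma conodal_neq0 i : (conodal i).[lam i] != 0.
Proof.
rewrite horner_prod; apply/prodf_neq0 => j ji; rewrite !hornerE subr_eq0.
by apply: contra ji => /eqP/lam_inj ->.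
Qed.

Definition lagrange_poly i : {poly K} := ell lam i 0 *: conodal i.

Lemma lagrange_polyE i j : (lagrange_poly i).[lam j] = (i == j)%:R.
Proof.
rewrite hornerZ ellE; have [<-|ij] := eqVneq i j.
  by rewrite mulVf// conodal_neq0.
by rewrite (conodal_eq0 ij) mulr0.
Qed.

Lemma size_lagrange_poly i : (size (lagrange_poly i) <= d)%N.
Proof.
apply: (leq_trans (size_scale_leq _ _)).
have c0 : conodal i != 0.
  by apply: contra_neq (conodal_neq0 i) => ->; rewrite horner0.
move: size_p; rewrite (nodalE i) size_monicM ?monicXsubC// size_XsubC.
by move=> -[<-].
Qed.

Definition lagrange_interp (a : 'cV[K]_d) : {poly K} :=
  \sum_i a i 0 *: lagrange_poly i.
Local Notation Lam := lagrange_interp.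

Lemma size_lagrange_interp a : (size (Lam a) <= d)%N.
Proof.
apply: (leq_trans (size_sum _ _ _)); apply/bigmax_leqP => i _.
exact: leq_trans (size_scale_leq _ _) (size_lagrange_poly i).
Qed.

Lemma horner_lagrange_interp a j : (Lam a).[lam j] = a j 0.
Proof.
rewrite horner_sum (bigD1 j)//= hornerZ lagrange_polyE eqxx mulr1.
rewrite big1 ?addr0// => i ij.
by rewrite hornerZ lagrange_polyE (negbTE ij) mulr0.
Qed.

Lemma lagrange_interp_inj : injective Lam.
Proof.
move=> a b ab; apply/matrixP => i j; rewrite (ord1 j).
by rewrite -!horner_lagrange_interp ab.
Qed.

Lemma lagrange_interpD a b : Lam (a + b) = Lam a + Lam b.
Proof. by rewrite -big_split; apply: eq_bigr => i _; rewrite mxE scalerDl. Qed.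

Lemma lagrange_interpZ c a : Lam (c *: a) = c *: Lam a.
Proof. by rewrite scaler_sumr; apply: eq_bigr => i _; rewrite mxE scalerA. Qed.

Lemma lagrange_interp1 : (0 < d)%N -> Lam (const_mx 1) = 1.
Proof.
move=> d0; apply: eq_poly_nodes => [||i]; first exact: size_lagrange_interp.
  by rewrite size_poly1.
by rewrite horner_lagrange_interp mxE hornerC.
Qed.

Lemma sum_lagrange_poly : (0 < d)%N -> \sum_i lagrange_poly i = 1.
Proof.
move=> d0; rewrite -(lagrange_interp1 d0); apply: eq_bigr => i _.
by rewrite mxE scale1r.
Qed.

(** Partial fractions: 1 / ((z - x) (z - y)) is the difference quotient of
    1 / (z - x) and 1 / (z - y). *)
Lemma lagrange_polyM i j : i != j ->
  lagrange_poly i * lagrange_poly j =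
  p * (Lmx lam i j *: (ell lam j 0 *: lagrange_poly i
                       - ell lam i 0 *: lagrange_poly j)).
Proof.
move=> ij; have ij0 : lam i - lam j != 0.
  by rewrite subr_eq0; apply: contra ij => /eqP/lam_inj ->.
pose D := \prod_(k < d | (k != i) && (k != j)) ('X - (lam k)%:P).
have ci : conodal i = ('X - (lam j)%:P) * D.
  by rewrite /conodal (bigD1 j) 1?eq_sym.
have cj : conodal j = ('X - (lam i)%:P) * D.
  rewrite /conodal (bigD1 i)//=; congr (_ * _).
  by apply: eq_bigl => k; rewrite andbC.
have ijV : (lam i - lam j)^-1%:P * ((lam i)%:P - (lam j)%:P) = 1.
  by rewrite -polyCB -polyCM mulVf.
rewrite mxE (negbTE ij) /lagrange_poly (nodalE i) ci cj -!mul_polyC.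
set u := (ell lam i 0)%:P; set v := (ell lam j 0)%:P.
rewrite -[LHS]mulr1 -ijV; ring.
Qed.

(** As the lagrange_poly add up to 1, the difference between the interpolant of
    the Hadamard product and Lam a * Lam b is the sum over i and j of
    a_i (b_i - b_j) times lagrange_poly i * lagrange_poly j.  By lagrange_polyM
    every term is divisible by p, and collecting the coefficients of each
    lagrange_poly produces box a next to box b. *)
Lemma lagrange_interpM w a b : (0 < d)%N ->
  Lam a * Lam b = Lam (polyprod_at lam w a b) - (p - w%:P) *
    Lam (hadamard (hadamard (Lmx lam) (box a)) (box b) *m ell lam).
Proof.
move=> d0; set c := _ *m ell lam.
rewrite /polyprod_at -/c -scaleN1r scalerA mulN1r.
rewrite lagrange_interpD lagrange_interpZ.
rewrite scaleNr -mul_polyC mulrBl opprB addrA subrK.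
suff : Lam (hadamard a b) - Lam a * Lam b = p * Lam c.
  by move=> <-; rewrite opprB addrC subrK.
pose T i j := Lmx lam i j * box b i j.
have TC i j : T i j = T j i.
  rewrite /T !mxE eq_sym; case: ifP => _; first by rewrite !mul0r.
  by rewrite -(opprB (lam i)) -(opprB (b i 0)) invrN mulrNN.
transitivity (\sum_i \sum_j
    (a i 0 * box b i j) *: (lagrange_poly i * lagrange_poly j)).
  have -> : Lam (hadamard a b) = \sum_i \sum_j
      (a i 0 * b i 0) *: (lagrange_poly i * lagrange_poly j).
    apply: eq_bigr => i _; rewrite -scaler_sumr -mulr_sumr sum_lagrange_poly//.
    by rewrite mulr1 !mxE.
  rewrite mulr_suml -sumrB; apply: eq_bigr => i _.
  rewrite mulr_sumr -sumrB; apply: eq_bigr => j _.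
  rewrite mxE mulrBr scalerBl; congr (_ - _).
  by rewrite -(scalerAl (a i 0)) -(scalerAr (b j 0)) scalerA.
transitivity (p * \sum_i \sum_j (a i 0 * T i j) *:
    (ell lam j 0 *: lagrange_poly i - ell lam i 0 *: lagrange_poly j)).
  rewrite mulr_sumr; apply: eq_bigr => i _; rewrite mulr_sumr.
  apply: eq_bigr => j _; have [<-|ij] := eqVneq i j.
    by rewrite /T !mxE eqxx subrr !(mulr0, mul0r, scale0r).
  rewrite lagrange_polyM// -scalerAr scalerA -scalerAr; congr (_ *: _).
  by rewrite /T; ring.
congr (_ * _).
(* Exchanging i and j in the second half turns a_i into a_j, T being symmetric. *)
under eq_bigr do under eq_bigr do rewrite scalerBr.
under eq_bigr do rewrite sumrB.
rewrite sumrB [X in _ - X]exchange_big -sumrB; apply: eq_bigr => i _.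
rewrite -sumrB mxE scaler_suml; apply: eq_bigr => j _.
rewrite (TC j i) !scalerA -scalerBl; congr (_ *: _).
by rewrite /T !mxE; ring.
Qed.

(** The left-hand side has degree less than d, the degree of p - w. *)
Lemma lagrange_interp_polyprod w a b : (0 < d)%N ->
  Lam (polyprod_at lam w a b) = (Lam a * Lam b) %% (p - w%:P).
Proof.
move=> d0; rewrite (lagrange_interpM w a b d0) -mulrN addrC modpD modp_mulr.
rewrite add0r modp_small// (leq_ltn_trans (size_lagrange_interp _))//.
rewrite size_polyDl size_p// size_polyN ltnS.
exact: leq_trans (size_polyC_leq1 _) d0.
Qed.

Lemma polyprod_atA w : (0 < d)%N -> associative (polyprod_at lam w).
Proof.
move=> d0 a b c; apply: lagrange_interp_inj.
rewrite !lagrange_interp_polyprod//.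
by rewrite modp_mul [_ %% _ * Lam c]mulrC modp_mul mulrA (mulrC (Lam c)).
Qed.

Lemma polyprod_atC w : (0 < d)%N -> commutative (polyprod_at lam w).
Proof.
move=> d0 a b; apply: lagrange_interp_inj.
by rewrite !lagrange_interp_polyprod// mulrC.
Qed.

End fiber_algebra.

Section fiber_linear.
Context {K : fieldType} {d : nat}.
Variables (lam : 'I_d -> K) (w : K).

Lemma polyprod_atE a b i : polyprod_at lam w a b i 0 = a i 0 * b i 0 -
  w * \sum_j Lmx lam i j * (a i 0 - a j 0) * (b i 0 - b j 0) * ell lam j 0.
Proof.
by rewrite !mxE; congr (_ - _ * _); apply: eq_bigr => j _; rewrite !mxE.
Qed.

Lemma polyprod_at1 : left_id (const_mx 1) (polyprod_at lam w).
Proof.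
move=> a; apply/matrixP => i j; rewrite (ord1 j) polyprod_atE !mxE mul1r.
by rewrite big1 ?mulr0 ?subr0// => k _; rewrite !mxE subrr mulr0 !mul0r.
Qed.

Lemma polyprod_atDl : left_distributive (polyprod_at lam w) +%R.
Proof.
move=> a b c; apply/matrixP => i j.
rewrite (ord1 j) [RHS]mxE !polyprod_atE addrACA -opprD -mulrDr -big_split/=.
rewrite mxE mulrDl; congr (_ - _ * _).
by apply: eq_bigr => k _; rewrite !mxE; ring.
Qed.

Lemma polyprod_atZl c a b :
  polyprod_at lam w (c *: a) b = c *: polyprod_at lam w a b.
Proof.
apply/matrixP => i j; rewrite (ord1 j) [RHS]mxE !polyprod_atE mulrBr mulrA mxE.
congr (_ - _); rewrite mulrCA; congr (_ * _); rewrite mulr_sumr.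
by apply: eq_bigr => k _; rewrite !mxE; ring.
Qed.

End fiber_linear.

(** * The operator norm of the regular representation *)

Section regular_norm.
Context {R : realType} {A : lmodType R[i]}.
Variables (mul : A -> A -> A) (one : A) (N : A -> R) (C : R).

Definition regular_norm (x : A) : R :=
  sup [set N (mul x y) | y in [set y | N y <= 1]].
Local Notation nrm := regular_norm.

Hypothesis mulA : associative mul.
Hypothesis mulC : commutative mul.
Hypothesis mul1 : left_id one mul.
Hypothesis mulDl : left_distributive mul +%R.
Hypothesis mulZl : forall (a : R[i]) x y, mul (a *: x) y = a *: mul x y.
Hypothesis N_eq0 : forall x, N x = 0 -> x = 0.
Hypothesis ND : forall x y, N (x + y) <= N x + N y.
Hypothesis NZ : forall (a : R[i]) x, N (a *: x) = cmod a * N x.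
Hypothesis N1 : N one = 1.
Hypothesis NM : forall x y, N (mul x y) <= C * N x * N y.
Hypothesis N_complete : forall u : nat -> A,
  (forall e : R, 0 < e -> exists n0, forall m n, (n0 <= m)%N -> (n0 <= n)%N ->
     N (u m - u n) < e) ->
  exists l : A, forall e : R, 0 < e -> exists n0, forall n, (n0 <= n)%N ->
     N (u n - l) < e.

Let N0 : N 0 = 0.
Proof. by rewrite -(scale0r one) NZ cmod0 mul0r. Qed.

Let N_ge0 x : 0 <= N x.
Proof.
have := ND x (-1 *: x); rewrite NZ cmodN cmod1 scaleN1r subrr N0 mul1r.
by lra.
Qed.

Let mulx1 x : mul x one = x.
Proof. by rewrite mulC mul1. Qed.

Let mulx0 x : mul x 0 = 0.
Proof. by rewrite mulC -(scale0r one) mulZl !scale0r. Qed.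

Let mulZr a x y : mul x (a *: y) = a *: mul x y.
Proof. by rewrite mulC mulZl mulC. Qed.

Let C_gt0 : 0 < C.
Proof. by have := NM one one; rewrite mul1 N1 !mulr1; lra. Qed.

Let regular_norm_sup x :
  has_sup [set N (mul x y) | y in [set y | N y <= 1]].
Proof.
split; first by exists (N (mul x one)); exists one => //=; rewrite N1.
exists (C * N x) => _ [y /= y1 <-]; apply: le_trans (NM _ _) _.
by rewrite ler_piMr// mulr_ge0// ltW.
Qed.

Lemma regular_norm_le x c :
  (forall y, N y <= 1 -> N (mul x y) <= c) -> nrm x <= c.
Proof.
move=> xc; apply: ge_sup; first by case: (regular_norm_sup x).
by move=> _ [y /= y1 <-]; exact: xc.
Qed.

Let le_regular_norm_ball x y : N y <= 1 -> N (mul x y) <= nrm x.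
Proof. by move=> y1; apply: sup_upper_bound => //; exists y. Qed.

Lemma le_regular_norm_mul x y : N (mul x y) <= nrm x * N y.
Proof.
have [/N_eq0 ->|Ny0] := eqVneq (N y) 0; first by rewrite mulx0 N0 mulr0.
have Ny_gt0 : 0 < N y by rewrite lt_neqAle eq_sym Ny0 N_ge0.
pose z := (N y)^-1%:C%C *: y.
have Nz : N z <= 1 by rewrite NZ cmod_real gtr0_norm ?invr_gt0// mulVf.
have : N (mul x z) <= nrm x.
  exact: le_regular_norm_ball.
by rewrite mulZr NZ cmod_real gtr0_norm ?invr_gt0// ler_pdivrMl// mulrC.
Qed.

Lemma le_regular_norm x : N x <= nrm x.
Proof. by have := le_regular_norm_mul x one; rewrite mulx1 N1 mulr1. Qed.

Lemma regular_norm_le_mul x : nrm x <= C * N x.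
Proof.
apply: regular_norm_le => y y1; apply: le_trans (NM _ _) _.
by rewrite ler_piMr// mulr_ge0// ltW.
Qed.

Lemma regular_norm_ge0 x : 0 <= nrm x.
Proof. exact: le_trans (N_ge0 x) (le_regular_norm x). Qed.

Lemma regular_norm_equivalent : equivalent_norms nrm N.
Proof.
exists 1, C; split=> // x; rewrite mul1r le_regular_norm.
by split=> //; exact: regular_norm_le_mul.
Qed.

Lemma regular_norm_banach : commutative_unital_banach_algebra mul one nrm.
Proof.
split=> //.
- move=> x x0; apply: N_eq0; apply/eqP.
  by rewrite eq_le N_ge0 andbT -x0 le_regular_norm.
- move=> x y; apply: regular_norm_le => z z1; rewrite mulDl.
  by apply: le_trans (ND _ _) _; rewrite lerD// le_regular_norm_ball.
- apply: homogeneous_of_le regular_norm_ge0 _ => a x.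
  apply: regular_norm_le => y y1.
  by rewrite mulZl NZ ler_wpM2l ?cmod_ge0// le_regular_norm_ball.
- move=> x y; apply: regular_norm_le => z z1; rewrite -mulA.
  apply: le_trans (le_regular_norm_mul _ _) _.
  by rewrite ler_wpM2l ?regular_norm_ge0// le_regular_norm_ball.
- apply/eqP; rewrite eq_le; apply/andP; split.
    by apply: regular_norm_le => y; rewrite mul1.
  by rewrite -[leLHS]N1 le_regular_norm.
- move=> u u_cauchy; have [|l ul] := N_complete (u := u).
    move=> e /u_cauchy[n0 un0]; exists n0 => m n mn0 nn0.
    exact: le_lt_trans (le_regular_norm _) (un0 _ _ mn0 nn0).
  exists l => e e0; have /ul[n0 un0] : 0 < e / C by rewrite divr_gt0.
  exists n0 => n /un0 une; apply: le_lt_trans (regular_norm_le_mul _) _.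
  by rewrite mulrC -ltr_pdivlMr.
Qed.

End regular_norm.

(** * Continuity and compactness in terms of the modulus *)

Section modulus_topology.
Context {R : realType}.

Lemma ler_dist_cmod (z1 z2 : R[i]) : `|cmod z1 - cmod z2| <= cmod (z1 - z2).
Proof.
rewrite ler_distlC.
have := le_cmodD (z1 - z2) z2; have := le_cmodD (z2 - z1) z1.
by rewrite !subrK (cmodB z2); lra.
Qed.

(** The radii of balls in R[i] are elements of R[i]; their positivity already
    makes them real. *)
Lemma gt0_real_complex (e : R[i]) : 0 < e -> exists2 r : R, 0 < r & e = r%:C%C.
Proof.
move=> e0; exists (cmod e); last by rewrite -cmodE gtr0_norm.
by rewrite -ltcR -cmodE normr_gt0 gt_eqF.
Qed.

Lemma continuous_cmodP (X : topologicalType) (n : nat) (f : X -> 'cV[R[i]]_n) :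
  continuous f <-> forall x (e : R), 0 < e ->
    \forall y \near x, forall j, cmod (f x j 0 - f y j 0) < e.
Proof.
split=> [cf x e e0|cf x].
  have /cvg_ballP/(_ e%:C%C) := cf x; rewrite ltcR => /(_ e0).
  apply: filterS => y [_ fy] j; rewrite -ltcR -cmodE; exact: fy.
apply/cvg_ballP => _ /gt0_real_complex[r r0 ->].
apply: filterS (cf x r r0) => y fy; split=> [|i j]; first by rewrite ltcR.
by rewrite (ord1 j) /ball/= cmodE ltcR; exact: fy.
Qed.

Lemma continuous_scalar_cmodP (X : topologicalType) (f : X -> R[i]) :
  continuous f <-> forall x (e : R), 0 < e ->
    \forall y \near x, cmod (f x - f y) < e.
Proof.
split=> [cf x e e0|cf x].
  have /cvg_ballP/(_ e%:C%C) := cf x; rewrite ltcR => /(_ e0).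
  by apply: filterS => y fy; rewrite -ltcR -cmodE; exact: fy.
apply/cvg_ballP => _ /gt0_real_complex[r r0 ->].
apply: filterS (cf x r r0) => y fy.
by rewrite /ball/= cmodE ltcR; exact: fy.
Qed.

Lemma compact_set_type (T : topologicalType) (A : set T) :
  compact A -> compact [set: A].
Proof.
move=> cA F PF _.
have [|x [Ax clx]] := cA (set_val @ F) _.
  suff AT : set_val @^-1` A = [set: A].
    by rewrite /fmap /= /nbhs/= AT; exact: filterT.
  by apply/seteqP; split=> // x _; exact: set_valP.
exists (exist _ x (mem_set Ax)); split=> // P Q FP.
move=> [_ [[U oU <-] Ux UQ]].
have FP' : F (set_val @^-1` (set_val @` P)).
  by apply: filterS FP => y Py; exists y.
have [_ [[y Py <-] Uy]] := clx _ _ FP' (open_nbhs_nbhs (conj oU Ux)).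
by exists y; split=> //; exact: UQ.
Qed.

Lemma compact_cmod_bounded (X : topologicalType) (f : X -> R[i]) :
  compact [set: X] -> continuous f ->
  exists2 B : R, 0 <= B & forall x, cmod (f x) <= B.
Proof.
move=> cX /continuous_scalar_cmodP cf.
have ccf : continuous (fun x => cmod (f x)).
  move=> x; apply/cvgrPdist_lt => e e0; apply: filterS (cf x e e0) => y.
  exact: le_lt_trans (ler_dist_cmod _ _).
have [|B [_ Bf]] := @compact_bounded _ _ ((fun x => cmod (f x)) @` setT).
  by apply: continuous_compact => //; exact: continuous_subspaceT.
exists (Num.max 0 (B + 1)); first by rewrite le_max lexx.
move=> x; apply: le_trans (ler_norm _) _; rewrite le_max; apply/orP; right.
by apply: Bf; [rewrite ltrDl | exists x].
Qed.

End modulus_topology.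

(** * Completeness of R[i] and of the uniform norm *)

Lemma cmodi (R : realType) : cmod 'i%C = 1 :> R.
Proof. by rewrite /cmod /= expr0n expr1n add0r sqrtr1. Qed.

Lemma complex_complete (R : realType) (v : nat -> R[i]) :
  (forall e : R, 0 < e -> exists n0, forall m n, (n0 <= m)%N -> (n0 <= n)%N ->
     cmod (v m - v n) < e) ->
  exists l : R[i], forall e : R, 0 < e ->
    \forall n \near \oo, cmod (v n - l) < e.
Proof.
move=> v_cauchy.
have part (h : R[i] -> R) : (forall z1 z2, `|h z1 - h z2| <= cmod (z1 - z2)) ->
    exists l : R, forall e : R, 0 < e ->
      \forall n \near \oo, `|h (v n) - l| < e.
  move=> hc; have /cvg_ex[l hl] : cvgn (fun n => h (v n)).
    apply/cauchy_cvgP/cauchy_exP => e /v_cauchy[n0 vn0]; exists (h (v n0)).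
    exists n0 => // n /= nn0; rewrite /ball/=.
    exact: le_lt_trans (hc _ _) (vn0 _ _ (leqnn _) nn0).
  exists l => e e0; move/cvgrPdist_lt : hl => /(_ e e0).
  by apply: filterS => n; rewrite distrC.
have [|a va] := part (@complex.Re R).
  by move=> [x1 y1] [x2 y2]; rewrite -sqrtr_sqr ler_wsqrtr//= lerDl sqr_ge0.
have [|b vb] := part (@complex.Im R).
  by move=> [x1 y1] [x2 y2]; rewrite -sqrtr_sqr ler_wsqrtr//= lerDr sqr_ge0.
exists (a +i* b)%C => e e0; have e20 : 0 < e / 2 by lra.
apply: filterS2 (va _ e20) (vb _ e20) => n an bn.
rewrite [v n]complexE [(a +i* b)%C]complexE /= opprD addrACA.
rewrite -mulrBr -!rmorphB/=; apply: le_lt_trans (le_cmodD _ _) _.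
by rewrite cmodM !cmod_real cmodi mul1r; lra.
Qed.

Section uniform_norm.
Context {R : realType} {d : nat}.
Variable M : set R[i].
Hypotheses (M0 : M !=set0) (Mc : compact M).
Implicit Types f g : CM d M.

Lemma coord_continuous_CM f (j : 'I_d) : continuous (fun w => f w j 0).
Proof.
apply/continuous_scalar_cmodP => x e e0.
have /continuous_cmodP/(_ x e e0) : continuous f by exact: cts_fun.
by apply: filterS => y; exact.
Qed.

Let maxnorm_has_sup f :
  has_sup [set \big[Num.max/0]_(j < d) complex.Re `|f w j 0| | w in [set: M]].
Proof.
split.
  case: M0 => w Mw; pose v : M := exist _ w (mem_set Mw).
  by exists (\big[Num.max/0]_(j < d) complex.Re `|f v j 0|); exists v.
have /choice[B BP] k : exists B : R, 0 <= B /\ forall x, cmod (f x k 0) <= B.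
  have [B] := compact_cmod_bounded (compact_set_type Mc)
    (@coord_continuous_CM f k).
  by exists B.
exists (\sum_k B k) => _ [x _ <-]; apply/bigmax_leP; split=> [|k _].
  by apply: sumr_ge0 => k _; case: (BP k).
apply: le_trans ((BP k).2 x) _; rewrite (bigD1 k)//= lerDl.
by apply: sumr_ge0 => i _; case: (BP i).
Qed.

Lemma maxnorm_ge0 f : 0 <= maxnorm f.
Proof.
have [[_ [w _ _]] _] := maxnorm_has_sup f.
apply: (@le_trans _ _ (\big[Num.max/0]_(j < d) cmod (f w j 0))).
  exact: bigmax_ge_id.
by apply: sup_upper_bound => //; exists w.
Qed.

Lemma le_maxnorm f w j : cmod (f w j 0) <= maxnorm f.
Proof.
apply: (@le_trans _ _ (\big[Num.max/0]_(j < d) cmod (f w j 0))).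
  exact: (le_bigmax _ (fun j => cmod (f w j 0))).
by apply: sup_upper_bound => //; exists w.
Qed.

Lemma maxnorm_le f (c : R) : 0 <= c ->
  (forall w j, cmod (f w j 0) <= c) -> maxnorm f <= c.
Proof.
move=> c0 fc; apply: ge_sup; first by case: (maxnorm_has_sup f).
by move=> _ [w _ <-]; apply/bigmax_leP; split=> // j _; exact: fc.
Qed.

Lemma maxnorm_eq0 f : maxnorm f = 0 -> f = 0.
Proof.
move=> f0; apply/continuousEP => w; apply/matrixP => j k.
rewrite (ord1 k) [RHS]mxE; apply: cmod_eq0; apply/eqP.
by rewrite eq_le cmod_ge0 andbT -f0 le_maxnorm.
Qed.

Lemma le_maxnormD f g : maxnorm (f + g) <= maxnorm f + maxnorm g.
Proof.
apply: maxnorm_le => [|w j]; first by rewrite addr_ge0// maxnorm_ge0.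
by rewrite mxE (le_trans (le_cmodD _ _))// lerD// le_maxnorm.
Qed.

Lemma maxnormZ (a : R[i]) f : maxnorm (a *: f) = cmod a * maxnorm f.
Proof.
apply: homogeneous_of_le maxnorm_ge0 _ a f => b h.
apply: maxnorm_le => [|w j]; first by rewrite mulr_ge0 ?cmod_ge0// maxnorm_ge0.
by rewrite mxE cmodM ler_wpM2l ?cmod_ge0// le_maxnorm.
Qed.

Lemma maxnorm1 : (0 < d)%N -> maxnorm (CM_one M : CM d M) = 1.
Proof.
move=> d0; apply/eqP; rewrite eq_le; apply/andP; split.
  by apply: maxnorm_le => // w j; rewrite mxE cmod1.
case: M0 => w Mw; rewrite -[leLHS]cmod1.
have := le_maxnorm (CM_one M) (exist _ w (mem_set Mw)) (Ordinal d0).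
by rewrite mxE.
Qed.

Lemma maxnorm_complete (u : nat -> CM d M) :
  (forall e : R, 0 < e -> exists n0, forall m n, (n0 <= m)%N -> (n0 <= n)%N ->
     maxnorm (u m - u n) < e) ->
  exists l : CM d M, forall e : R, 0 < e -> exists n0, forall n, (n0 <= n)%N ->
     maxnorm (u n - l) < e.
Proof.
move=> u_cauchy.
have coordB w j m n : cmod (u m w j 0 - u n w j 0) <= maxnorm (u m - u n).
  by have := le_maxnorm (u m - u n) w j; rewrite !mxE.
have /choice[l ul] : forall w : M, exists l : 'cV[R[i]]_d,
    forall j (e : R), 0 < e ->
      \forall n \near \oo, cmod (u n w j 0 - l j 0) < e.
  move=> w; have /choice[l ul] j : exists l : R[i], forall e : R, 0 < e ->
      \forall n \near \oo, cmod (u n w j 0 - l) < e.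
    apply: complex_complete => e /u_cauchy[n0 un0]; exists n0 => m n mn0 nn0.
    exact: le_lt_trans (coordB _ _ _ _) (un0 _ _ mn0 nn0).
  by exists (\col_j l j) => j e e0; rewrite mxE; exact: ul.
(* Letting m tend to infinity in the Cauchy condition makes the convergence
   uniform in w. *)
have unif (e : R) : 0 < e -> exists n0, forall n, (n0 <= n)%N -> forall w j,
    cmod (u n w j 0 - l w j 0) <= e.
  move=> e0; have [n0 un0] := u_cauchy (e / 2) ltac:(lra).
  exists n0 => n nn0 w j.
  near \oo => m.
  have -> : u n w j 0 - l w j 0 =
      (u n w j 0 - u m w j 0) + (u m w j 0 - l w j 0) by ring.
  have mn0 : (n0 <= m)%N by near: m; exact: nbhs_infty_ge.
  have h1 : cmod (u m w j 0 - l w j 0) < e / 2 by near: m; apply: ul; lra.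
  have h2 := le_lt_trans (coordB w j n m) (un0 n m nn0 mn0).
  by apply: le_trans (le_cmodD _ _) _; lra.
have cl : continuous l.
  apply/continuous_cmodP => w e e0.
  have [|n0 un0] := unif (e / 3); first by lra.
  have /continuous_cmodP/(_ w (e / 3)) : continuous (u n0) by exact: cts_fun.
  move=> /(_ ltac:(lra)); apply: filterS => y uny j.
  have h1 := un0 n0 (leqnn _) w j; have h2 := un0 n0 (leqnn _) y j.
  have h3 := uny j.
  have -> : l w j 0 - l y j 0 = (l w j 0 - u n0 w j 0)
     + (u n0 w j 0 - u n0 y j 0) + (u n0 y j 0 - l y j 0) by ring.
  have := le_cmodD ((l w j 0 - u n0 w j 0)
     + (u n0 w j 0 - u n0 y j 0)) (u n0 y j 0 - l y j 0).
  have := le_cmodD (l w j 0 - u n0 w j 0) (u n0 w j 0 - u n0 y j 0).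
  by rewrite (cmodB (l w j 0)); lra.
exists (mkcts cl) => e e0; have [|n0 un0] := unif (e / 2); first by lra.
exists n0 => n nn0; apply: (@le_lt_trans _ _ (e / 2)); last by lra.
apply: maxnorm_le => [|w j]; first by lra.
by rewrite !mxE; exact: un0.
Unshelve. all: by end_near.
Qed.

End uniform_norm.

(** * The Banach algebra *)

Section CLambda_algebra.
Context {R : realType} {d : nat}.
Variables (lam : 'I_d -> R[i]) (M : set R[i]).
Hypotheses (d0 : (0 < d)%N) (lam_inj : injective lam).
Hypotheses (M0 : M !=set0) (Mc : compact M).

Lemma maxnorm_polyprod : exists C : R, forall f g : CM d M,
  maxnorm (polyprod lam f g) <= C * maxnorm f * maxnorm g.
Proof.
have [B B0 MB] := compact_cmod_bounded (compact_set_type Mc)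
  (@initial_continuous M _ (@set_val _ M)).
pose S := \sum_i \sum_j cmod (Lmx lam i j) * cmod (ell lam j 0).
have S0 i : 0 <= \sum_j cmod (Lmx lam i j) * cmod (ell lam j 0).
  by apply: sumr_ge0 => j _; rewrite mulr_ge0 ?cmod_ge0.
exists (1 + B * (4 * S)) => f g.
set nf := maxnorm f; set ng := maxnorm g.
have nf0 : 0 <= nf by exact: maxnorm_ge0.
have ng0 : 0 <= ng by exact: maxnorm_ge0.
apply: (maxnorm_le M0 Mc) => [|w i].
  by rewrite !mulr_ge0// addr_ge0// !mulr_ge0// sumr_ge0.
have box2 (h : CM d M) j : cmod (h w i 0 - h w j 0) <= 2 * maxnorm h.
  apply: le_trans (le_cmodD _ _) _; rewrite cmodN mulr2n mulrDl mul1r.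
  by rewrite lerD// (le_maxnorm M0 Mc).
rewrite polyprod_atE; apply: le_trans (le_cmodD _ _) _.
have -> : (1 + B * (4 * S)) * nf * ng = nf * ng + B * (S * (4 * (nf * ng))).
  by ring.
rewrite cmodN !cmodM lerD ?ler_pM ?cmod_ge0 ?(le_maxnorm M0 Mc)//.
apply: le_trans (le_cmod_sum _ _) _.
apply: (@le_trans _ _ (\sum_j (cmod (Lmx lam i j) * cmod (ell lam j 0)) *
   (4 * (nf * ng)))).
  apply: ler_sum => j _; rewrite !cmodM.
  have -> : cmod (Lmx lam i j) * cmod (f w i 0 - f w j 0) *
    cmod (g w i 0 - g w j 0) * cmod (ell lam j 0) =
    (cmod (Lmx lam i j) * cmod (ell lam j 0)) *
     (cmod (f w i 0 - f w j 0) * cmod (g w i 0 - g w j 0)) by ring.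
  rewrite ler_wpM2l ?mulr_ge0 ?cmod_ge0//.
  have -> : 4 * (nf * ng) = (2 * nf) * (2 * ng) by ring.
  by rewrite ler_pM ?cmod_ge0.
rewrite -mulr_suml ler_wpM2r ?mulr_ge0//.
by rewrite [leRHS](bigD1 i)// lerDl sumr_ge0.
Qed.

Lemma CLambda_banach :
  commutative_unital_banach_algebra
    (@polyprod R d lam M) (@CM_one R d M) (@polynorm R d lam M) /\
  equivalent_norms (@polynorm R d lam M) (@maxnorm R d M).
Proof.
have [C polyprodC] := maxnorm_polyprod.
have mulC : commutative (@polyprod R d lam M).
  by move=> f g; apply/continuousEP => w; exact: polyprod_atC.
have mul1 : left_id (@CM_one R d M) (@polyprod R d lam M).
  by move=> f; apply/continuousEP => w; exact: polyprod_at1.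
have mulZ (a : R[i]) (f g : CM d M) :
    polyprod lam (a *: f) g = a *: polyprod lam f g.
  by apply/continuousEP => w; exact: polyprod_atZl.
have eq0 := @maxnorm_eq0 _ d _ M0 Mc.
have nD := @le_maxnormD _ d _ M0 Mc.
have nZ := @maxnormZ _ d _ M0 Mc.
have n1 := maxnorm1 M0 Mc d0.
split;
  last exact: (regular_norm_equivalent mulC mul1 mulZ eq0 nD nZ n1 polyprodC).
apply: (@regular_norm_banach R (CM d M) (@polyprod R d lam M) _
  (@maxnorm R d M) C) => //.
- by move=> f g h; apply/continuousEP => w; exact: polyprod_atA.
- by move=> f g h; apply/continuousEP => w; exact: polyprod_atDl.
- exact: maxnorm_complete.
Qed.

End CLambda_algebra.

(** * Bump functions polynomial in w and its conjugate *)

Lemma horner2_continuous (K : numFieldType) (X : topologicalType)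
    (q : {poly {poly K}}) (x y : X -> K) : continuous x -> continuous y ->
  continuous (fun w => q.[(x w)%:P].[y w]).
Proof.
move=> cx cy.
have inner (r : {poly K}) : continuous (fun w => r.[y w]).
  elim/poly_ind : r => [|r a IH].
    rewrite (_ : (fun w => _) = cst 0); first exact: cst_continuous.
    by apply/funext => w; rewrite horner0.
  rewrite (_ : (fun w => _) = (fun w => r.[y w] * y w + a)).
    move=> w; apply: cvgD; last exact: cvg_cst.
    by apply: cvgM; [exact: IH | exact: cy].
  by apply/funext => w; rewrite hornerMXaddC.
elim/poly_ind : q => [|q r IH].
  rewrite (_ : (fun w => _) = cst 0); first exact: cst_continuous.
  by apply/funext => w; rewrite !horner0.
rewrite (_ : (fun w => _) = (fun w => q.[(x w)%:P].[y w] * x w + r.[y w])).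
  move=> w; apply: cvgD; last exact: inner.
  by apply: cvgM; [exact: IH | exact: cx].
by apply/funext => w; rewrite hornerMXaddC hornerD hornerM hornerC.
Qed.

(** The function (1 - u^n)^(k^n) of u in [0, 1] changes from nearly 1 to nearly 0
    around u = 1/k, the more sharply the larger n is. *)
Section real_bump.
Context {R : realType}.

Lemma bernoulli_ineq (x : R) n : -1 <= x -> 1 + n%:R * x <= (1 + x) ^+ n.
Proof.
move=> x1; elim: n => [|n IH]; first by rewrite mul0r addr0 expr0.
rewrite exprS -natr1; apply: le_trans (ler_wpM2l _ IH); last by lra.
have : 0 <= n%:R * x ^+ 2 by rewrite mulr_ge0 ?sqr_ge0.
by rewrite expr2; nra.
Qed.

Variables (u : R) (k n : nat).
Hypotheses (u01 : 0 <= u <= 1).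
Let un01 : 0 <= u ^+ n <= 1.
Proof. by case/andP: u01 => u0 u1; rewrite exprn_ge0 ?exprn_ile1. Qed.

Lemma bump_itv : 0 <= (1 - u ^+ n) ^+ (k ^ n) <= 1.
Proof. by have /andP[? ?] := un01; rewrite exprn_ge0 ?exprn_ile1; lra. Qed.

(** Here k^n u^n is at most 2^-n, so that Bernoulli's inequality applies to
    (1 - u^n)^(k^n) directly. *)
Lemma bump_near1 : k%:R * u <= 2^-1 -> 1 - 2^-1 ^+ n <= (1 - u ^+ n) ^+ (k ^ n).
Proof.
case/andP: u01 => u0 _ ku; have /andP[un0 un1] := un01.
apply: le_trans (bernoulli_ineq _ _); last by lra.
by rewrite mulrN lerD2l lerN2 natrX -exprMn lerXn2r// nnegrE ?mulr_ge0.
Qed.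

(** Multiplied by (1 + u^n)^(k^n), which is at least (k u)^n by Bernoulli's
    inequality, the left-hand side becomes (1 - u^(2n))^(k^n), at most 1. *)
Lemma bump_near0 : 2 <= k%:R * u -> (1 - u ^+ n) ^+ (k ^ n) <= 2^-1 ^+ n.
Proof.
case/andP: u01 => u0 _ ku; have /andP[un0 un1] := un01.
have b := bernoulli_ineq (k ^ n)%N (x := u ^+ n) ltac:(lra).
have N0 : 0 <= (1 - u ^+ n) ^+ (k ^ n) by case/andP: bump_itv.
have : (1 - u ^+ n) ^+ (k ^ n) * (1 + u ^+ n) ^+ (k ^ n) <= 1.
  by rewrite -exprMn exprn_ile1 //; nra.
have : 2 ^+ n <= (1 + u ^+ n) ^+ (k ^ n).
  apply: le_trans b; rewrite natrX -exprMn.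
  apply: (@le_trans _ _ ((k%:R * u) ^+ n)); last by lra.
  by rewrite lerXn2r// nnegrE; lra.
move=> le2 le1; rewrite exprVn -[leRHS]mul1r ler_pdivlMr ?exprn_gt0//.
exact: le_trans (ler_wpM2l N0 le2) le1.
Qed.

End real_bump.

Section polynomial_bump.
Context {R : realType}.
Implicit Types (q : {poly {poly R[i]}}) (w c : R[i]).

Definition conj_horner q w : R[i] := q.[w%:P].[(w^*)%C].

Lemma conj_hornerC (a w : R[i]) : conj_horner (a%:P%:P) w = a.
Proof. by rewrite /conj_horner !hornerC. Qed.

Lemma conj_hornerD q1 q2 w :
  conj_horner (q1 + q2) w = conj_horner q1 w + conj_horner q2 w.
Proof. by rewrite /conj_horner !hornerD. Qed.

Lemma conj_hornerB q1 q2 w :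
  conj_horner (q1 - q2) w = conj_horner q1 w - conj_horner q2 w.
Proof. by rewrite /conj_horner !hornerE. Qed.

Lemma conj_hornerM q1 q2 w :
  conj_horner (q1 * q2) w = conj_horner q1 w * conj_horner q2 w.
Proof. by rewrite /conj_horner !hornerM. Qed.

Lemma conj_hornerXn q n w : conj_horner (q ^+ n) w = conj_horner q w ^+ n.
Proof. by rewrite /conj_horner !horner_exp. Qed.

Lemma conj_horner1 w : conj_horner 1 w = 1.
Proof. by rewrite /conj_horner !hornerC. Qed.

Definition sqdist_poly c : {poly {poly R[i]}} :=
  ('X - c%:P%:P) * ('X%:P - ((c^*)%C)%:P%:P).

Lemma sqdist_polyE c w :
  conj_horner (sqdist_poly c) w = ((cmod (w - c)) ^+ 2)%:C%C.
Proof.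
rewrite conj_hornerM !conj_hornerB !conj_hornerC.
rewrite /conj_horner hornerX !hornerC hornerX.
by rewrite rmorphXn/= -cmodE sqr_normc rmorphB.
Qed.

Lemma polynomial_bump (B : R) c (rho eps : R) : 0 < rho -> 0 < eps ->
  exists q, exists h : R[i] -> R, forall w, cmod (w - c) <= B ->
  [/\ conj_horner q w = (h w)%:C%C, 0 <= h w <= 1,
      rho <= cmod (w - c) -> h w <= eps &
      cmod (w - c) <= rho / 2 -> 1 - eps <= h w].
Proof.
move=> rho0 eps0.
have [n n2] : exists n, 2^-1 ^+ n <= eps.
  exists (Num.bound eps^-1); rewrite exprVn invf_ple ?posrE ?exprn_gt0//.
  exact/ltW/upper_nthrootP.
pose k := (Num.bound (2 * B ^+ 2 / rho ^+ 2)).+1.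
(* The transition radius must lie between rho / 2 and rho.  With k t rho^2 = 2,
   u = t |w - c|^2 satisfies k u >= 2 from radius rho on and k u <= 1/2 up to
   radius rho / 2; k is large enough for u <= 1 at distance B. *)
pose t : R := 2 / (k%:R * rho ^+ 2).
have r20 : 0 < rho ^+ 2 by rewrite exprn_gt0.
have t0 : 0 < t by rewrite divr_gt0// mulr_gt0// ltr0n.
have kt : k%:R * t = 2 / rho ^+ 2.
  by rewrite /t; field; rewrite gt_eqF// pnatr_eq0.
have tB : t * B ^+ 2 <= 1.
  rewrite /t mulrAC ler_pdivrMr ?mulr_gt0 ?ltr0n// mul1r -ler_pdivrMr//.
  apply: le_trans (ltW (archi_boundP _)) _; last by rewrite ler_nat.
  by apply: divr_ge0; [apply: mulr_ge0 => //|]; exact: sqr_ge0.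
pose u w := t * cmod (w - c) ^+ 2.
exists ((1 - (t%:C%C%:P%:P * sqdist_poly c) ^+ n) ^+ (k ^ n)).
exists (fun w => (1 - u w ^+ n) ^+ (k ^ n)) => w wB.
have u01 : 0 <= u w <= 1.
  rewrite mulr_ge0 ?sqr_ge0 ?(ltW t0)//=; apply: le_trans tB.
  rewrite ler_wpM2l ?(ltW t0)// lerXn2r ?nnegrE ?cmod_ge0//.
  by rewrite (le_trans _ wB)// cmod_ge0.
split.
- rewrite conj_hornerXn conj_hornerB conj_horner1 conj_hornerXn conj_hornerM.
  rewrite conj_hornerC sqdist_polyE -rmorphM.
  by rewrite [RHS]rmorphXn rmorphB rmorph1 rmorphXn.
- exact: bump_itv.
- move=> cw; apply: le_trans (bump_near0 _ u01 _) n2.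
  rewrite mulrA kt mulrAC ler_pdivlMr// ler_pM2l//.
  by rewrite lerXn2r ?nnegrE ?cmod_ge0// ltW.
- move=> cw; apply: le_trans (bump_near1 _ u01 _); first by lra.
  rewrite mulrA kt mulrAC ler_pdivrMr//.
  have : cmod (w - c) ^+ 2 <= (rho / 2) ^+ 2.
    by rewrite lerXn2r ?nnegrE ?cmod_ge0// ltW// divr_gt0.
  rewrite expr_div_n; lra.
Qed.

End polynomial_bump.

(** * Density of the polynomials in w and its conjugate *)

Section density.
Context {R : realType} {d : nat}.
Variable M : set R[i].
Hypotheses (M0 : M !=set0) (Mc : compact M).
Implicit Types (f : CM d M) (w c : M).

Lemma conj_horner_continuous (q : {poly {poly R[i]}}) :
  continuous (fun w : M => conj_horner q (set_val w)).
Proof.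
have cval : continuous (@set_val _ M) by exact: initial_continuous.
have cconj : continuous (fun w : M => ((set_val w)^*)%C).
  apply/continuous_scalar_cmodP => x e e0.
  have /continuous_scalar_cmodP/(_ x e e0) := cval.
  by apply: filterS => y; rewrite -rmorphB /cmod normcJ.
exact: (@horner2_continuous R[i] M q set_val (fun w => ((set_val w)^*)%C)
  cval cconj).
Qed.

Lemma small_oscillation_radius f (e : R) c : 0 < e -> exists2 rho : R, 0 < rho &
  forall w, cmod (set_val w - set_val c) < rho ->
    forall j, cmod (f w j 0 - f c j 0) <= e.
Proof.
move=> e0; have /continuous_cmodP/(_ c e e0) : continuous f by exact: cts_fun.
move=> [_ [[U oU <-] Uc sub]].
have /nbhs_ballP[_ /gt0_real_complex[r r0 ->] rU] :=
  open_nbhs_nbhs (conj oU Uc).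
exists r => // w wc j; rewrite cmodB; apply/ltW/sub/rU.
by rewrite /ball/= cmodE ltcR cmodB.
Qed.

(** Here miss is the product of 1 - h over the bumps h used so far: the part of
    the initial error B that has not been removed yet.  It is small as soon as one
    of the discs of half radius contains w.  The other two terms of the bound are
    the oscillation of f on the discs and, for each center, the effect of its bump
    outside its disc. *)
Lemma polynomial_patching f (D B e eps : R) (s : seq (M * R)) :
  0 < e -> 0 < eps ->
  (forall w c, cmod (set_val w - set_val c) <= D) ->
  (forall w j, cmod (f w j 0) <= B) ->
  (forall cr, cr \in s -> 0 < cr.2 /\
     forall w, cmod (set_val w - set_val cr.1) < cr.2 ->
       forall j, cmod (f w j 0 - f cr.1 j 0) <= e) ->
  exists (q : 'I_d -> {poly {poly R[i]}}) (miss : M -> R), forall w,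
    [/\ 0 <= miss w <= 1,
        forall cr, cr \in s -> cmod (set_val w - set_val cr.1) <= cr.2 / 2 ->
          miss w <= eps &
        forall j, cmod (f w j 0 - conj_horner (q j) (set_val w)) <=
          e + 2 * B * eps * (size s)%:R + B * miss w].
Proof.
move=> e0 eps0 MD fB; elim: s => [_|[c rho] s IH sP].
  exists (fun=> 0), (fun=> 1) => w; split=> // [|j].
    by rewrite lexx ler01.
  by rewrite /conj_horner !horner0 subr0 mulr1 mulr0; have := fB w j; lra.
have [|q [miss qmiss]] := IH.
  by move=> cr crs; apply: sP; rewrite inE crs orbT.
have [rho0 fc] := sP _ (mem_head _ _); rewrite /= in rho0 fc.
have [b [h bh]] := polynomial_bump D (set_val c) rho0 eps0.
exists (fun j => q j + ((f c j 0)%:P%:P - q j) * b).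
exists (fun w => miss w * (1 - h (set_val w))) => w.
have [bE /andP[h0 h1] hfar hnear] := bh (set_val w) (MD w c).
have [/andP[miss0 miss1] miss_s qE] := qmiss w.
split=> [|cr|j].
- by rewrite mulr_ge0 ?mulr_ile1//; lra.
- rewrite inE => /orP[/eqP->/= /hnear hw|crs wcr].
    by apply: (@le_trans _ _ (1 - h (set_val w))); [rewrite ler_piMl|]; lra.
  by apply: le_trans (miss_s _ crs wcr); rewrite ler_piMr//; lra.
set H := h (set_val w) in bE h0 h1 hfar hnear *.
have B0 : 0 <= B by exact: le_trans (cmod_ge0 _) (fB w j).
have -> : f w j 0 -
      conj_horner (q j + ((f c j 0)%:P%:P - q j) * b) (set_val w) =
    (f w j 0 - conj_horner (q j) (set_val w)) * (1 - H)%:C%C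
    + (f w j 0 - f c j 0) * H%:C%C.
  rewrite conj_hornerD conj_hornerM conj_hornerB conj_hornerC bE.
  by rewrite (_ : (1 - H)%:C%C = 1 - H%:C%C); [ring | exact: rmorphB].
have {qE}E1 := ler_wpM2r (_ : 0 <= 1 - H) (qE j).
(* Either f w is within e of f c, or the bump is at most eps at w. *)
have E2 : cmod (f w j 0 - f c j 0) * H <= e * H + 2 * B * eps.
  have [wc|wc] := ltP (cmod (set_val w - set_val c)) rho.
    have := ler_wpM2r h0 (fc w wc j).
    by have := mulr_ge0 B0 (ltW eps0); lra.
  have : cmod (f w j 0 - f c j 0) * H <= 2 * B * eps.
    rewrite ler_pM ?cmod_ge0//; last exact: hfar.
    by apply: le_trans (le_cmodD _ _) _; rewrite cmodN;
      have := fB w j; have := fB c j; lra.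
  by have := mulr_ge0 (ltW e0) h0; lra.
apply: le_trans (le_cmodD _ _) _.
rewrite !cmodM !cmod_real (ger0_norm h0) ger0_norm; last by lra.
rewrite /= -natr1.
have := E1 ltac:(lra).
have X0 : 0 <= 2 * B * eps * (size s)%:R * H.
  by rewrite !mulr_ge0// ltW.
move: X0 E2; lra.
Qed.

Lemma polynomial_in_conj_dense :
  dense_for (@maxnorm R d M) [set f | polynomial_in_conj f].
Proof.
move=> f e e0.
have [W W0 MW] := compact_cmod_bounded (compact_set_type Mc)
  (@initial_continuous M _ (@set_val _ M)).
pose B := maxnorm f; have B0 : 0 <= B by exact: maxnorm_ge0.
have e40 : 0 < e / 4 by lra.
have /choice[rho rhoP] c : exists rho : R, 0 < rho /\
  forall w, cmod (set_val w - set_val c) < rho ->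
    forall j, cmod (f w j 0 - f c j 0) <= e / 4.
  by have [r] := small_oscillation_radius f c e40; exists r.
pose U (c : M) := [set z : R[i] | cmod (z - set_val c) <= rho c / 2].
move: Mc; rewrite compact_cover => /(_ M setT (fun c => (U c)°)).
case=> [c _|z Mz|F _ MF]; first exact: open_interior.
  pose c : M := exist _ z (mem_set Mz); exists c => //.
  apply/nbhs_ballP; exists (rho c / 2)%:C%C.
    by rewrite /= ltcR; have [] := rhoP c; lra.
  by move=> y; rewrite /ball/= cmodE ltcR /U/= cmodB => /ltW.
pose s : seq (M * R) := [seq (c, rho c) | c <- finmap.enum_fset F].
(* With this eps the patching error is at most e / 4 + e / 4 at every point of a
   half disc, where miss is at most eps. *)
pose eps : R := e / (4 * (1 + 2 * B * (size s)%:R + B)).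
have den0 : 0 < 1 + 2 * B * (size s)%:R + B.
  by have : 0 <= 2 * B * (size s)%:R; [rewrite !mulr_ge0 | lra].
have eps0 : 0 < eps by rewrite divr_gt0// mulr_gt0.
have epsE : (1 + 2 * B * (size s)%:R + B) * eps = e / 4.
  by rewrite /eps; field; rewrite gt_eqF.
have [w c|w j|cr|q [miss qmiss]] :=
  @polynomial_patching f (W + W) B (e / 4) eps s e40 eps0.
- by apply: le_trans (le_cmodD _ _) _; rewrite cmodN lerD// MW.
- exact: le_maxnorm.
- by move=> /mapP[c _ ->]; exact: rhoP.
have cq : continuous (fun w : M => \col_j conj_horner (q j) (set_val w)).
  apply/continuous_cmodP => x r r0.
  pose P (j : 'I_d) (y : M) :=
    cmod (conj_horner (q j) (set_val x) - conj_horner (q j) (set_val y)) < r.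
  have : \forall y \near x, forall j, P j y.
    apply: (@filter_forall _ _ P (nbhs x)) => j.
    by have /continuous_scalar_cmodP/(_ x r r0) := @conj_horner_continuous (q j).
  by apply: filterS => y Py j; rewrite !mxE; exact: Py.
pose g : CM d M := mkcts cq.
exists g; first by exists q => w j; rewrite mxE.
apply: (@le_lt_trans _ _ (e / 2)); last by lra.
apply: (maxnorm_le M0 Mc) => [|w j]; first by lra.
rewrite !mxE; have [_ miss_s /(_ j)] := qmiss w; move/le_trans; apply.
have [c Fc /interior_subset wc] := MF _ (set_valP w).
have := miss_s (c, rho c) (map_f _ Fc) wc.
move=> /(ler_wpM2l B0); lra.
Qed.

End density.

Unset Implicit Arguments.

Theorem theorem2p11 (R : realType) (d : nat) (lam : 'I_d -> R[i])
    (M : set R[i]) :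
  (0 < d)%N -> injective lam -> M !=set0 -> compact M ->
  [/\ commutative_unital_banach_algebra
        (@polyprod R d lam M) (@CM_one R d M) (@polynorm R d lam M),
      equivalent_norms (@polynorm R d lam M) (@maxnorm R d M) &
      dense_for (@polynorm R d lam M) [set f | polynomial_in_conj f]].
Proof.
move=> d0 lam_inj M0 Mc.
have [banach equiv] := CLambda_banach d0 lam_inj M0 Mc.
split=> // f e e0; case: equiv => c1 [c2 [_ c20 c12]].
have [g gpoly fg] := polynomial_in_conj_dense M0 Mc f (divr_gt0 e0 c20).
exists g => //; apply: le_lt_trans (c12 _).2 _.
by rewrite mulrC -ltr_pdivlMr.
Qed.
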